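(* Let $n\ge 3$. If $\mathcal{H}=(V,\mathcal{E})$ is a $4$-uniform hypergraph with $EI(\mathcal{H})=C_n$, then $n\ge 11$.
   Context: Hypergraphs $\mathcal{H}=(V,\mathcal{E})$ have no multiple hyperedges; isolated vertices are allowed. $\mathcal{H}$ is $4$-uniform if every hyperedge has exactly $4$ elements. The edge intersection hypergraph of $\mathcal{H}$ is $EI(\mathcal{H})=(V,\mathcal{E}^{EI})$ with $\mathcal{E}^{EI}=\{e_1\cap e_2: e_1,e_2\in\mathcal{E},\ e_1\ne e_2,\ |e_1\cap e_2|\ge 2\}$. $C_n$ is the cycle with vertex set $\{1,\dots,n\}$ and edges $\{i,i+1\}$, $i=1,\dots,n$ (indices mod $n$); ''$EI(\mathcal{H})=C_n$'' means $V=\{1,\dots,n\}$ and $\mathcal{E}^{EI}$ is exactly the edge set of $C_n$. *)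

(* Defs.v *)
From mathcomp Require Import all_boot.
Set Implicit Arguments.
Unset Strict Implicit.
Unset Printing Implicit Defensive.

(* A hypergraph on the vertex set V is given by its set of hyperedges; being a
   set, it has no multiple hyperedges. Isolated vertices are allowed. *)
Definition hypergraph (V : finType) := {set {set V}}.

Definition uniform (V : finType) (k : nat) (H : hypergraph V) : Prop :=
  forall e : {set V}, e \in H -> #|e| = k.

Definition EI (V : finType) (H : hypergraph V) : hypergraph V :=
  [set e1 :&: e2 | e1 in H, e2 in H & (e1 != e2) && (2 <= #|e1 :&: e2|)].

(* The vertex i.+1 of {1, ..., n} is represented by i : 'I_n; ordS is the
   successor modulo n. *)
Definition cycle_graph (n : nat) : hypergraph 'I_n :=
  [set [set i; ordS i] | i : 'I_n].

(* Main.v *)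
(* Suppose that no hyperedge contains the path i, i+1, i+2 of the cycle.  Take
   hyperedges e, e' meeting in {i, i+1} and f, f' meeting in {i+1, i+2}.  A
   common pair of e or e' with f or f' would be an edge of the cycle at i+1, and
   this would put the path into one of them; so the 6-sets e U e' and f U f'
   share only i+1, and their union has 11 vertices.  Hence, if n <= 10, every path of
   three vertices lies in a hyperedge.  With this information, a small
   backtracking search refutes each of the remaining values of n. *)
Require Import Defs.
From mathcomp Require Import all_boot.

Lemma EI_cycle_meet (n : nat) (H : hypergraph 'I_n) (e f : {set 'I_n}) :
    EI H = cycle_graph n -> e \in H -> f \in H -> e != f -> 2 <= #|e :&: f| ->
  exists i, e :&: f = [set i; ordS i].
Proof.
move=> EI_H eH fH e'f ef2; have: e :&: f \in EI H.
  by apply/imset2P; exists e f; rewrite // inE fH e'f.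
by rewrite EI_H => /imsetP[i _ ->]; exists i.
Qed.

Lemma EI_cycle_edge (n : nat) (H : hypergraph 'I_n) (i : 'I_n) :
    EI H = cycle_graph n ->
  exists e f, [/\ e \in H, f \in H, e != f, e :&: f = [set i; ordS i]
                & #|e :&: f| = 2].
Proof.
move=> EI_H; have: [set i; ordS i] \in EI H by rewrite EI_H; apply/imset_f.
case/imset2P=> e f eH; rewrite inE => /and3P[fH e'f ef2] def_ef.
(* [EI] keeps only intersections of size at least 2, and a pair has at most 2 elements. *)
exists e, f; split=> //; apply/eqP; rewrite eqn_leq ef2 andbT -def_ef.
by rewrite cards2; case: eqP.
Qed.

Lemma EI_cycle_meet1 (n : nat) (H : hypergraph 'I_n) (i : 'I_n)
    (e f : {set 'I_n}) :
    EI H = cycle_graph n -> e \in H -> f \in H ->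
    [set i; ordS i] \subset e -> ordS (ordS i) \notin e ->
    [set ordS i; ordS (ordS i)] \subset f -> i \notin f ->
  e :&: f = [set ordS i].
Proof.
move=> EI_H eH fH; rewrite !subUset !sub1set.
move=> /andP[i0e i1e] i2'e /andP[i1f i2f] i0'f.
apply/esym/eqP; rewrite eqEcard sub1set inE i1e i1f cards1 leqNgt.
apply/negP=> ef2; have e'f: e != f by apply: contraNneq i0'f => <-.
have [j def_ef] := EI_cycle_meet _ _ _ _ EI_H eH fH e'f ef2.
have: ordS i \in e :&: f by rewrite inE i1e.
(* The edge at [j] contains [ordS i]: if [j = ordS i], it puts [ordS (ordS i)] into [e]; if [j = i],
   it puts [i] into [f]. *)
rewrite def_ef !inE => /orP[/eqP def_j | /eqP/(can_inj (@ordSK n)) def_j].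
  have: ordS j \in e :&: f by rewrite def_ef !inE eqxx orbT.
  by rewrite -def_j inE (negPf i2'e).
have: j \in e :&: f by rewrite def_ef !inE eqxx.
by rewrite -def_j inE (negPf i0'f) andbF.
Qed.

Lemma EI_cycle_path (n : nat) (H : hypergraph 'I_n) (i : 'I_n) :
    uniform 4 H -> EI H = cycle_graph n -> n < 11 ->
  exists2 e, e \in H & [set i; ordS i; ordS (ordS i)] \subset e.
Proof.
move=> H_unif EI_H n_lt11; apply/exists_inP; apply: contraLR n_lt11.
rewrite negb_exists_in -leqNgt => /forall_inP noP.
have [e [e' [eH e'H _ ee' ee'2]]] := EI_cycle_edge _ _ i EI_H.
have [f [f' [fH f'H _ ff' ff'2]]] := EI_cycle_edge _ _ (ordS i) EI_H.
have [se se']: [set i; ordS i] \subset e /\ [set i; ordS i] \subset e'.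
  by rewrite -ee' subsetIl subsetIr.
have [sf sf']: [set ordS i; ordS (ordS i)] \subset f
            /\ [set ordS i; ordS (ordS i)] \subset f'.
  by rewrite -ff' subsetIl subsetIr.
have notL g : g \in H -> [set i; ordS i] \subset g -> ordS (ordS i) \notin g.
  by move=> gH sg; apply: contra (noP g gH) => ?; rewrite subUset sg sub1set.
have notR g : g \in H -> [set ordS i; ordS (ordS i)] \subset g -> i \notin g.
  move=> gH sg; apply: contra (noP g gH) => ?.
  by rewrite -setUA subUset sg sub1set andbT.
have meet1 g h : g \in H -> h \in H -> [set i; ordS i] \subset g ->
    [set ordS i; ordS (ordS i)] \subset h -> g :&: h = [set ordS i].
  by move=> gH hH sg sh; apply: (EI_cycle_meet1 _ _ _ _ _ EI_H); auto.
(* 11 = (4 + 4 - 2) + (4 + 4 - 2) - 1, as all four mixed intersections equal [[set ordS i]]. *)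
have: #|(e :|: e') :|: (f :|: f')| = 11.
  rewrite cardsU setIUl !setIUr !meet1 // !setUid cards1 !cardsU ee'2 ff'2.
  by rewrite (H_unif e) // (H_unif e') // (H_unif f) // (H_unif f').
by move=> <-; rewrite -[leqRHS]card_ord max_card.
Qed.

(* A requirement (k, c) asks for k distinct members of the list c in the family
   under construction, of which chosen is the part already selected.  The test
   below is an if because vm_compute evaluates both arguments of ||. *)
Fixpoint unsatisfiable (T : eqType) (compat : rel T) (chosen : seq T)
    (reqs : seq (nat * seq T)) : bool :=
  if reqs is (k, c) :: reqs' then
    if k <= count [in c] chosen then unsatisfiable T compat chosen reqs' else
    all (fun x => if (x \notin chosen) && all (compat x) chosen
                  then unsatisfiable T compat (x :: chosen) reqs' else true) c
  else false.

(** A family [S] meeting all requirements guides the search: a branch that selects only members of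
    [S] passes every compatibility test and never gets stuck. Adding at most one member per
    requirement only weakens the test, so it stays sound. *)
Lemma unsatisfiable_sound (T : eqType) (compat : rel T) (S : seq T)
    (chosen : seq T) (reqs : seq (nat * seq T)) :
    {in S &, forall x y, compat x y} -> uniq chosen -> {subset chosen <= S} ->
    (forall k c, (k, c) \in reqs ->
       exists s, [/\ uniq s, size s = k, {subset s <= c} & {subset s <= S}]) ->
  ~~ unsatisfiable T compat chosen reqs.
Proof.
move=> S_compat; elim: reqs chosen => [|[k c] reqs IHreqs] chosen //=.
move=> Uch chS Sreqs.
have{}IHreqs ch : uniq ch -> {subset ch <= S} ->
    ~~ unsatisfiable T compat ch reqs.
  move=> Uc cS; apply: IHreqs => // k' c' r.
  by apply: Sreqs; rewrite inE r orbT.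
case: leqP => [_|]; first exact: IHreqs.
have [s [Us <- sc sS]] := Sreqs k c (mem_head _ _).
(* If all branches failed, every member of [s] would already be chosen, and the count would reach
   [size s]. *)
rewrite ltnNge; apply: contraNN => /allP all_c.
rewrite -size_filter; apply: uniq_leq_size => // x xs.
rewrite mem_filter /= sc //=; apply: contraT => x'ch.
have := all_c x (sc x xs); rewrite x'ch /=; case: allP => [_ | []]; last first.
  by move=> y ych; apply: S_compat; [apply: sS | apply: chS].
apply: contraTT => _; apply: IHreqs; rewrite /= ?x'ch // => y.
by rewrite inE => /predU1P[->|/chS//]; apply: sS.
Qed.

Fixpoint combinations (k : nat) (T : Type) (s : seq T) : seq (seq T) :=
  if s is x :: s' then
    (if k is k'.+1 then map (cons x) (combinations k' T s') else [::])
      ++ combinations k T s'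
  else if k is 0 then [:: [::]] else [::].

Lemma mem_combinations (T : eqType) (p : pred T) (s : seq T) :
  filter p s \in combinations (count p s) T s.
Proof.
elim: s => //= x s IHs; rewrite mem_cat; case: (p x) => /=.
  by rewrite map_f.
by rewrite IHs orbT.
Qed.

(** Sorted lists of numbers let the search run under [vm_compute]; being canonical, they turn
    equality of sets into equality of lists. *)
Definition code (n : nat) (A : {set 'I_n}) : seq nat :=
  [seq x <- iota 0 n | x \in map val (enum A)].

Lemma mem_code (n : nat) (A : {set 'I_n}) (i : 'I_n) :
  (val i \in code n A) = (i \in A).
Proof.
by rewrite mem_filter mem_iota /= ltn_ord andbT (mem_map val_inj) mem_enum.
Qed.

Lemma code_inj (n : nat) : injective (code n).
Proof. by move=> A B AB; apply/setP=> i; rewrite -!mem_code AB. Qed.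

Lemma codeE (n : nat) (A : {set 'I_n}) (p : pred nat) :
  (forall i : 'I_n, (i \in A) = p i) -> code n A = [seq x <- iota 0 n | p x].
Proof.
move=> Ap; apply: eq_in_filter => x; rewrite mem_iota /= => x_n.
by rewrite -[x]/(val (Ordinal x_n)) (mem_map val_inj) mem_enum Ap.
Qed.

Lemma codeI (n : nat) (A B : {set 'I_n}) :
  code n (A :&: B) = [seq x <- code n A | x \in code n B].
Proof.
rewrite -filter_predI; apply: codeE => i /=.
by rewrite !mem_code inE andbC (mem_map val_inj) mem_enum.
Qed.

Lemma size_code (n : nat) (A : {set 'I_n}) : size (code n A) = #|A|.
Proof.
rewrite cardE -(size_map val); apply/perm_size/uniq_perm.
- by rewrite filter_uniq ?iota_uniq.
- by rewrite (map_inj_uniq val_inj) enum_uniq.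
move=> x; rewrite mem_filter mem_iota; case: mapP => // -[i _ ->] /=.
exact: ltn_ord.
Qed.

(** Filtering [iota] puts the closing edge in increasing order too, as in [code]. *)
Definition cycle_edge (n i : nat) : seq nat :=
  [seq x <- iota 0 n | x \in [:: i; i.+1 %% n]].

Definition compatible (edges : seq (seq nat)) (s t : seq nat) : bool :=
  (s == t) || let u := [seq x <- s | x \in t] in (size u <= 1) || (u \in edges).

(** Paths come first: once they are processed, each cycle edge lies in a chosen quadruple, so the
    single addition made per requirement is enough to reach 2. *)
Definition requirements (n : nat) : seq (nat * seq (seq nat)) :=
  let quads := combinations 4 _ (iota 0 n) in
  let containing s := [seq q <- quads | all [in q] s] in
  [seq (1, containing [:: i; i.+1 %% n; i.+2 %% n]) | i <- iota 0 n]
    ++ [seq (2, containing [:: i; i.+1 %% n]) | i <- iota 0 n].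

Lemma requirements_unsatisfiable (n : nat) : 3 <= n < 11 ->
  unsatisfiable _ (compatible (map (cycle_edge n) (iota 0 n))) [::]
    (requirements n).
Proof.
(* The eight values 3, ..., 10 are refuted by one boolean computation. *)
move=> n_bounds; have: n \in iota 3 8 by rewrite mem_iota.
by move: n {n_bounds}; apply/allP; vm_compute.
Qed.

Lemma code_cycle_edge (n : nat) (i : 'I_n) :
  code n [set i; ordS i] = cycle_edge n i.
Proof. by apply: codeE => j; rewrite !inE. Qed.

Lemma code_combinations (n : nat) (A : {set 'I_n}) :
  code n A \in combinations #|A| _ (iota 0 n).
Proof. by rewrite -size_code size_filter mem_combinations. Qed.

Lemma code_compatible (n : nat) (H : hypergraph 'I_n) (e f : {set 'I_n}) :
    EI H = cycle_graph n -> e \in H -> f \in H ->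
  compatible (map (cycle_edge n) (iota 0 n)) (code n e) (code n f).
Proof.
move=> EI_H eH fH; rewrite /compatible -codeI size_code.
have [-> | e'f] := eqVneq e f; first by rewrite eqxx.
case: leqP => [_ | ef2]; first by rewrite orbT.
have [i ->] := EI_cycle_meet _ _ _ _ EI_H eH fH e'f ef2.
by rewrite code_cycle_edge map_f ?orbT // mem_iota ltn_ord.
Qed.

Theorem theorem4 (n : nat) (n_ge3 : 3 <= n) (H : hypergraph 'I_n)
  (H_unif : uniform 4 H) (EI_H : EI H = cycle_graph n) : 11 <= n.
Proof.
rewrite leqNgt; apply/negP=> n_lt11.
have := requirements_unsatisfiable n; rewrite n_ge3 n_lt11 => /(_ isT).
apply/negP/(unsatisfiable_sound _ _ (map (code n) (enum H))) => //.
  move=> _ _ /mapP[e eH ->] /mapP[f fH ->].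
  by rewrite !mem_enum in eH fH; apply: code_compatible EI_H _ _.
move=> k c; rewrite mem_cat.
case/orP=> /mapP[i]; rewrite mem_iota => /= i_n [-> ->].
  have [e eH] := EI_cycle_path _ _ (Ordinal i_n) H_unif EI_H n_lt11.
  rewrite !subUset !sub1set -!mem_code /= => /andP[/andP[i0e i1e] i2e].
  exists [:: code n e]; split=> // _ /[!inE] /eqP->; last first.
    by rewrite map_f ?mem_enum.
  rewrite mem_filter /= i0e i1e -(H_unif e eH) code_combinations.
  (* Applying [ordS] twice reduces modulo [n] twice, whereas [requirements] reduces [i.+2] once. *)
  by move: i2e; rewrite -(addn1 (i.+1 %% n)) modnDml addn1 => ->.
have [e [f [eH fH e'f ef ef2]]] := EI_cycle_edge _ _ (Ordinal i_n) EI_H.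
exists [:: code n e; code n f].
have in_c g : g \in H -> [set Ordinal i_n; ordS (Ordinal i_n)] \subset g ->
    code n g \in [seq q <- combinations 4 _ (iota 0 n)
                  | all [in q] [:: i; i.+1 %% n]].
  rewrite subUset !sub1set -!mem_code /= => gH /andP[i0g i1g].
  by rewrite mem_filter /= i0g i1g -(H_unif g gH) code_combinations.
split=> //=; first by rewrite inE (inj_eq (code_inj n)) e'f.
  move=> _ /[!inE] /pred2P[]->; apply: in_c => //; rewrite -ef.
    exact: subsetIl.
  exact: subsetIr.
by move=> _ /[!inE] /pred2P[]->; rewrite map_f ?mem_enum.
Qed.
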